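(* Let $P=(\Sigma,R)$ be a TSS in the ntyft/ntyxt format with recursion. Then the bisimulation preorder $\sqsubseteq_B$ is a lean precongruence: for every term $t\in\mathbb{T}(\Sigma)$ and all closed substitutions $\rho,\nu:\mathrm{Var}\to\mathrm{T}(\Sigma)$ with $\rho(x)\sqsubseteq_B\nu(x)$ for all $x\in\mathrm{Var}$, one has $t[\rho]\sqsubseteq_B t[\nu]$.
   Context: Terms with recursion $\mathbb{T}(\Sigma)$ over $\Sigma$: variables, $f(t_1,\dots,t_n)$ for $(f,n)\in\Sigma$, and $\langle X|S\rangle$ for $S:V_S\to\mathbb{T}(\Sigma)$, $V_S\subseteq\mathrm{Var}$, $X\in V_S$ (binding $V_S$). $\mathrm{T}(\Sigma)$ = closed terms. A closed substitution is a total map $\mathrm{Var}\to\mathrm{T}(\Sigma)$; $t[\rho]$ is capture-avoiding replacement of free variables. $\langle t|S\rangle$ abbreviates $t[\langle Y|S\rangle/Y]_{Y\in V_S}$. Literals $t\xrightarrow{a}t'$ and $t\not\xrightarrow{a}$ deny each other; rules $\frac{H}{\alpha}$; TSS $P=(\Sigma,R)$; $P\vdash\frac{H}{\alpha}$ means a well-founded proof tree exists whose leaves lie in $H$ and whose other nodes are substitution instances of rules in $R$. Well-founded semantics: for ordinals $\lambda$, $PT^-_\lambda$ = closed negative literals denying no element of $CT^+_\kappa$ for $\kappa<\lambda$; $PT^+_\lambda$ = closed positive $\beta$ with $P\vdash\frac{PT^-_\lambda}{\beta}$; $CT^-_\lambda$ = closed negative literals denying no element of $PT^+_\lambda$; $CT^+_\lambda$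 = closed positive $\beta$ with $P\vdash\frac{CT^-_\lambda}{\beta}$; these stabilise to $CT^+,PT^+$. Write $P\vdash p\xrightarrow{a}q$ for $(p\xrightarrow{a}q)\in CT^+$ and $P\vdash p\dashrightarrow^{a}q$ for $(p\xrightarrow{a}q)\in PT^+$. A bisimulation is a relation $\mathcal{R}\subseteq\mathrm{T}(\Sigma)\times\mathrm{T}(\Sigma)$ such that whenever $p\mathcal{R}q$: if $P\vdash p\xrightarrow{a}p'$ then there is $q'$ with $P\vdash q\xrightarrow{a}q'$ and $p'\mathcal{R}q'$; and if $P\vdash q\dashrightarrow^{a}q'$ then there is $p'$ with $P\vdash p\dashrightarrow^{a}p'$ and $p'\mathcal{R}q'$. $p\sqsubseteq_B q$ (modal refinement / bisimilarity) iff some bisimulation relates them. ntyft/ntyxt format with recursion: for every recursive specification $S$, $X\in V_S$, $a\in A$ the TSS contains the rule $\frac{\langle S_X|S\rangle\xrightarrow{a}z}{\langle X|S\rangle\xrightarrow{a}z}$, and all other rules are ntyft or ntyxt rules, where an ntytt rule is one whose positive premises have as right-hand sides distinct variables not occurring in the source; it is ntyxt if the source is a variable and ntyft if the source contains exactly one function symbol and no repeated variables. *)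

(* Defs.v *)
From Stdlib Require Import List.
From Stdlib Require Vectors.Fin.
Set Warnings "-stdlib-vector".


Section Syntax.
Variables (Var F : Type) (arity : F -> nat).

(* Terms with recursion: a recursive specification Sp : V_S -> T(Sigma) is
   represented as a partial map [Var -> option term], V_S = {Y | Sp Y <> None}. *)
Inductive term : Type :=
| var : Var -> term
| app : forall f : F, (Fin.t (arity f) -> term) -> term
| rec : (Var -> option term) -> Var -> term.

Inductive wf : term -> Prop :=
| wf_var x : wf (var x)
| wf_app f ts : (forall i, wf (ts i)) -> wf (app f ts)
| wf_rec Sp X : Sp X <> None -> (forall Y u, Sp Y = Some u -> wf u) -> wf (rec Sp X).

Inductive free (x : Var) : term -> Prop :=
| fv_var : free x (var x)
| fv_app f ts i : free x (ts i) -> free x (app f ts)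
| fv_rec Sp X Y u : Sp Y = Some u -> free x u -> Sp x = None -> free x (rec Sp X).

Definition closed (t : term) : Prop := wf t /\ forall x, ~ free x t.

Definition closed_subst (rho : Var -> term) : Prop := forall x, closed (rho x).

(* substitution, with the bound variables V_S shadowed under <X|Sp>.  It is
   capture-avoiding whenever the substituted terms are closed, which is the
   case for every use below. *)
Definition shadow (Sp : Var -> option term) (sigma : Var -> term) : Var -> term :=
  fun Y => match Sp Y with Some _ => var Y | None => sigma Y end.

Fixpoint subst (sigma : Var -> term) (t : term) : term :=
  match t with
  | var x => sigma x
  | app f ts => app f (fun i => subst sigma (ts i))
  | rec Sp X =>
      rec (fun Y => match Sp Y with
                    | Some u => Some (subst (shadow Sp sigma) u)
                    | None => None
                    end) X
  end.

Definition unfold (Sp : Var -> option term) (X : Var) : term :=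
  match Sp X with
  | Some u => subst (fun Y => match Sp Y with Some _ => rec Sp Y | None => var Y end) u
  | None => rec Sp X
  end.

Variable A : Type.

Inductive lit : Type :=
| Pos : term -> A -> term -> lit   (* t --a--> t' *)
| Neg : term -> A -> lit.          (* t -/a-> *)

Definition subst_lit (rho : Var -> term) (l : lit) : lit :=
  match l with
  | Pos t a u => Pos (subst rho t) a (subst rho u)
  | Neg t a => Neg (subst rho t) a
  end.

Record rule : Type := Rule {
  prem : lit -> Prop;
  csrc : term;
  cact : A;
  ctgt : term }.

Definition ntytt (r : rule) : Prop :=
  (forall s a u, prem r (Pos s a u) -> exists y, u = var y /\ ~ free y (csrc r)) /\
  (forall s a s' a' y, prem r (Pos s a (var y)) -> prem r (Pos s' a' (var y)) ->
     s = s' /\ a = a').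

Definition ntyxt (r : rule) : Prop := ntytt r /\ exists x, csrc r = var x.

Definition ntyft (r : rule) : Prop :=
  ntytt r /\ exists (f : F) (xs : Fin.t (arity f) -> Var),
    (forall i j, xs i = xs j -> i = j) /\ csrc r = app f (fun i => var (xs i)).

(* The TSS P = (Sigma, R_all) where R_all consists of the rules [R] (all
   ntyft/ntyxt) together with the recursion rules
     <S_X|Sp> --a--> z  /  <X|Sp> --a--> z   (all Sp, X in V_S, a).
   P |- H / beta for closed H and closed beta: a well-founded proof tree whose
   leaves are in H and whose other nodes are closed substitution instances of
   rules of R_all.  The closed instances of the recursion rules are exactly
   unfold Sp X --a--> q / <X|Sp> --a--> q with <X|Sp>, q closed. *)
Inductive proves (R : rule -> Prop) (H : lit -> Prop) : lit -> Prop :=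
| pr_hyp l : H l -> proves R H l
| pr_rule r rho : R r -> closed_subst rho ->
    (forall l, prem r l -> proves R H (subst_lit rho l)) ->
    proves R H (Pos (subst rho (csrc r)) (cact r) (subst rho (ctgt r)))
| pr_rec Sp X a q : closed (rec Sp X) -> closed q ->
    proves R H (Pos (unfold Sp X) a q) -> proves R H (Pos (rec Sp X) a q).

(* sets of closed positive literals are represented as term -> A -> term -> Prop *)

Definition denying_none (C : term -> A -> term -> Prop) (l : lit) : Prop :=
  exists t a, l = Neg t a /\ closed t /\ forall t', ~ C t a t'.

Definition Gamma (R : rule -> Prop) (C : term -> A -> term -> Prop)
  : term -> A -> term -> Prop :=
  fun p a q => closed p /\ closed q /\ proves R (denying_none C) (Pos p a q).

(* Well-founded semantics.  PT^+_lam = Gamma (U_{k<lam} CT^+_k) and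
   CT^+_lam = Gamma PT^+_lam; the increasing transfinite sequence CT^+_lam
   stabilises at the least fixed point of the monotone map Gamma o Gamma, and
   PT^+ = Gamma CT^+. *)
Definition CT (R : rule -> Prop) : term -> A -> term -> Prop :=
  fun p a q => forall X : term -> A -> term -> Prop,
    (forall p' a' q', Gamma R (Gamma R X) p' a' q' -> X p' a' q') -> X p a q.

Definition PT (R : rule -> Prop) : term -> A -> term -> Prop := Gamma R (CT R).

Definition bisimulation (R : rule -> Prop) (Rel : term -> term -> Prop) : Prop :=
  forall p q, Rel p q ->
    closed p /\ closed q /\
    (forall a p', CT R p a p' -> exists q', CT R q a q' /\ Rel p' q') /\
    (forall a q', PT R q a q' -> exists p', PT R p a p' /\ Rel p' q').

Definition refines (R : rule -> Prop) (p q : term) : Prop :=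
  exists Rel, bisimulation R Rel /\ Rel p q.

End Syntax.

Arguments var {Var F arity}.
Arguments app {Var F arity} f ts.
Arguments rec {Var F arity}.
Arguments wf {Var F arity}.
Arguments free {Var F arity}.
Arguments closed {Var F arity}.
Arguments closed_subst {Var F arity}.
Arguments shadow {Var F arity}.
Arguments subst {Var F arity}.
Arguments unfold {Var F arity}.
Arguments Pos {Var F arity A}.
Arguments Neg {Var F arity A}.
Arguments subst_lit {Var F arity A}.
Arguments Rule {Var F arity A}.
Arguments prem {Var F arity A}.
Arguments csrc {Var F arity A}.
Arguments cact {Var F arity A}.
Arguments ctgt {Var F arity A}.
Arguments ntytt {Var F arity A}.
Arguments ntyxt {Var F arity A}.
Arguments ntyft {Var F arity A}.
Arguments proves {Var F arity A}.
Arguments denying_none {Var F arity A}.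
Arguments Gamma {Var F arity A}.
Arguments CT {Var F arity A}.
Arguments PT {Var F arity A}.
Arguments bisimulation {Var F arity A}.
Arguments refines {Var F arity A}.

(* Main.v *)
From Stdlib Require Import List.
From Stdlib Require Vectors.Fin.
From Stdlib Require Import ClassicalEpsilon FunctionalExtensionality PropExtensionality.
Require Import Defs.

(** Two terms are related when the second arises from the first by replacing
    pairwise incomparable subterm occurrences by terms that refine them.  Such a
    replacement is recorded as a set of marks: positions paired with a
    replacement.

    The premises of a rule may depend on each other circularly, so its
    substitution instance cannot be rebuilt premise by premise.  Instead, a proof
    of [p --a--> p'] determines how marks of [p] propagate to marks of [p']: a
    mark enters the variables of the source of a rule, moves from a variable
    into the premises where it occurs, from there (by induction on the proof) to
    the variables that are targets of premises, and finally to the target of the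
    rule; a mark on a whole source is answered by the bisimulation game.
    Propagation inside one rule is the least relation closed under these steps,
    so circular premises are harmless, and since every mark has a single
    ancestor, incomparable marks stay incomparable.  Replacing the marks of [p]
    and the resulting marks of [p'] then yields a transition again.

    Applied to the stages of the well-founded semantics, in the two directions
    alternatingly, this makes the relation above a bisimulation. *)

(** * Positions, substitution and occurrences of variables *)

Inductive step (V : Type) : Type :=
| arg : nat -> step V
| body : V -> step V.
Arguments arg {V}.
Arguments body {V}.

Section Marks.
Context {Var F : Type} {arity : F -> nat}.
Notation term := (term Var F arity).
Notation pos := (list (step Var)).
Notation marks := (pos -> term -> Prop).

(** Bodies of a specification sit under a function and [option]; the third case supplies the
    induction hypothesis for each of them. *)
Lemma term_induction (P : term -> Prop)
  (Hv : forall x, P (var x))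
  (Ha : forall f ts, (forall i, P (ts i)) -> P (app f ts))
  (Hr : forall Sp X, (forall Y u, Sp Y = Some u -> P u) -> P (rec Sp X)) :
  forall t, P t.
Proof.
fix IH 1; intros [x|f ts|Sp X].
- apply Hv.
- apply Ha; intros i; apply IH.
- apply Hr; intros Y.
  (* The match is on [Sp Y] itself and the equation is transported, so that the recursive call is on
     the structural subterm [u0]. *)
  exact (match Sp Y as o return forall u, o = Some u -> P u with
         | Some u0 => fun u e =>
             match e in _ = o return match o with Some w => P w | None => True end with
             | eq_refl => IH u0
             end
         | None => fun u e =>
             match e in _ = o return match o with Some w => P w | None => True end with
             | eq_refl => I
             end
         end).
Qed.

Lemma subst_id_on_free (t : term) : forall sigma,
  (forall x, free x t -> sigma x = var x) -> subst sigma t = t.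
Proof.
induction t as [x|f ts IH|Sp X IH] using term_induction; intros sigma Hs; simpl.
- apply Hs; constructor.
- f_equal; extensionality i; apply IH; intros x Hx; apply Hs; econstructor; exact Hx.
- f_equal; extensionality Y; destruct (Sp Y) as [u|] eqn:E; [|reflexivity].
  f_equal; apply (IH Y u E); intros x Hx; unfold shadow.
  destruct (Sp x) eqn:Ex; [reflexivity|].
  apply Hs; econstructor; eauto.
Qed.

Lemma subst_closed sigma (t : term) : closed t -> subst sigma t = t.
Proof.
intros [_ H]; apply subst_id_on_free; intros x Hx; destruct (H x Hx).
Qed.

Lemma wf_subst (t : term) : forall sigma,
  wf t -> (forall x, wf (sigma x)) -> wf (subst sigma t).
Proof.
induction t as [x|f ts IH|Sp X IH] using term_induction; intros sigma Ht Hs; simpl.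
- apply Hs.
- constructor; intros i; apply IH; auto.
  enough (G : forall t, wf t -> match t with app f ts => forall i, wf (ts i) | _ => True end)
    by exact (G _ Ht i).
  intros t [] ; auto.
- inversion Ht as [| |? ? H1 H2]; subst; constructor.
  + destruct (Sp X); congruence.
  + intros Y u; destruct (Sp Y) as [v|] eqn:E; [|discriminate].
    intros [= <-]; apply (IH Y v E); [eauto|].
    intros x; unfold shadow; destruct (Sp x); auto; constructor.
Qed.

Lemma free_subst (t : term) : forall sigma x,
  free x (subst sigma t) -> exists y, free y t /\ free x (sigma y).
Proof.
induction t as [y|f ts IH|Sp X IH] using term_induction; intros sigma x H; simpl in H.
- exists y; split; [constructor|exact H].
- enough (G : exists i, free x (subst sigma (ts i))).
  { destruct G as [i Hi]; destruct (IH i _ _ Hi) as (y & H1 & H2).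
    exists y; split; [econstructor; exact H1|exact H2]. }
  enough (G : forall t, free x t ->
    match t with app f ts => exists i, free x (ts i) | _ => True end)
    by exact (G _ H).
  intros t []; eauto.
- inversion H as [| |? ? Y u H1 H2 H3]; subst.
  destruct (Sp Y) as [v|] eqn:E; [|discriminate]; injection H1 as <-.
  destruct (IH Y v E _ _ H2) as (y & G1 & G2); unfold shadow in G2.
  destruct (Sp y) eqn:Ey.
  + inversion G2; subst; rewrite Ey in H3; discriminate.
  + exists y; split; [econstructor; eauto|exact G2].
Qed.

Lemma closed_subst_wf (t : term) sigma :
  wf t -> closed_subst sigma -> closed (subst sigma t).
Proof.
intros Ht Hs; split.
- apply wf_subst; [exact Ht|]; intros x; apply Hs.
- intros x Hx; destruct (free_subst _ _ _ Hx) as (y & _ & Hy).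
  exact (proj2 (Hs y) x Hy).
Qed.

Definition fin_index {n} (i : Fin.t n) : nat := proj1_sig (Fin.to_nat i).

Lemma fin_index_inj n (i j : Fin.t n) : fin_index i = fin_index j -> i = j.
Proof. apply Fin.to_nat_inj. Qed.

(** Below [rec Sp X] a position may enter the body of any [Y], whatever [X] is. Hence all [rec Sp Y]
    with the same [Sp] share their positions below the root, which is what lets marks survive
    unfolding. *)
Fixpoint subterm_at (ps : pos) (t t0 : term) : Prop :=
  match ps with
  | nil => t = t0
  | arg n :: ps' =>
      match t with
      | app f ts => exists i, fin_index i = n /\ subterm_at ps' (ts i) t0
      | _ => False
      end
  | body Y :: ps' =>
      match t with
      | rec Sp X => match Sp Y with Some u => subterm_at ps' u t0 | None => False end
      | _ => False
      end
  end.

Fixpoint occurs (t : term) (v : Var) (ps : pos) : Prop :=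
  match t with
  | var x => x = v /\ ps = nil
  | app f ts => exists i ps', ps = arg (fin_index i) :: ps' /\ occurs (ts i) v ps'
  | rec Sp X => Sp v = None /\ exists Y ps', ps = body Y :: ps' /\
      match Sp Y with Some u => occurs u v ps' | None => False end
  end.

Lemma occurs_free (t : term) : forall v ps, occurs t v ps -> free v t.
Proof.
induction t as [x|f ts IH|Sp X IH] using term_induction; intros v ps; simpl.
- intros [-> _]; constructor.
- intros (i & ps' & _ & H); econstructor; eapply IH; exact H.
- intros (H & Y & ps' & _ & G); destruct (Sp Y) as [u|] eqn:E; [|destruct G].
  econstructor; eauto.
Qed.

(** Variables are leaves, so a path through a term meets at most one variable occurrence. *)
Lemma occurs_incomparable (t : term) : forall v v' p p' r r',
  occurs t v p -> occurs t v' p' -> p ++ r = p' ++ r' -> p = p' /\ v = v'.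
Proof.
induction t as [x|f ts IH|Sp X IH] using term_induction; intros v v' p p' r r'; simpl.
- intros [-> ->] [-> ->]; auto.
- intros (i & ps & -> & H) (i' & ps' & -> & H') E; simpl in E.
  injection E as E1 E2; apply fin_index_inj in E1; subst i'.
  destruct (IH i _ _ _ _ _ _ H H' E2) as [-> ->]; auto.
- intros (_ & Y & ps & -> & H) (_ & Y' & ps' & -> & H') E; simpl in E.
  injection E as <- E2; destruct (Sp Y) as [u|] eqn:EY; [|destruct H].
  destruct (IH _ _ EY _ _ _ _ _ _ H H' E2) as [-> ->]; auto.
Qed.

Lemma subterm_at_occurs (t : term) : forall sigma v p ps t0,
  occurs t v p ->
  subterm_at (p ++ ps) (subst sigma t) t0 <-> subterm_at ps (sigma v) t0.
Proof.
induction t as [x|f ts IH|Sp X IH] using term_induction; intros sigma v p ps t0; simpl.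
- intros [-> ->]; reflexivity.
- intros (i & ps' & -> & H); simpl; rewrite <- (IH i sigma v ps' ps t0 H).
  split.
  + intros (j & E & G); apply fin_index_inj in E; subst j; exact G.
  + intros G; exists i; auto.
- intros (Hv & Y & ps' & -> & H); simpl.
  destruct (Sp Y) as [u|] eqn:E; [|destruct H].
  rewrite (IH _ _ E (shadow Sp sigma) v ps' ps t0 H); unfold shadow; rewrite Hv.
  reflexivity.
Qed.

Lemma subterm_at_subst : forall ps (t t0 : term) sigma,
  subterm_at ps t t0 -> exists tau, subterm_at ps (subst sigma t) (subst tau t0).
Proof.
induction ps as [|[n|Y] ps IH]; intros t t0 sigma H; simpl in H.
- subst; exists sigma; reflexivity.
- destruct t as [|f ts|]; try contradiction; destruct H as (i & E & H).
  destruct (IH _ _ sigma H) as [tau G]; exists tau; simpl; eauto.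
- destruct t as [| |Sp X]; try contradiction; destruct (Sp Y) as [u|] eqn:E; [|contradiction].
  destruct (IH _ _ (shadow Sp sigma) H) as [tau G]; exists tau; simpl; rewrite E; exact G.
Qed.

Lemma subterm_at_closed ps (t t0 : term) sigma :
  closed t0 -> subterm_at ps t t0 -> subterm_at ps (subst sigma t) t0.
Proof.
intros H G; destruct (subterm_at_subst _ _ _ sigma G) as [tau G'].
rewrite (subst_closed tau t0 H) in G'; exact G'.
Qed.

(** A free variable of [t] cannot lie inside a closed subterm, and nothing lies below a variable. *)
Lemma closed_subterm_not_occurs (t : term) : forall ps t0 v p r r',
  subterm_at ps t t0 -> closed t0 -> occurs t v p -> p ++ r = ps ++ r' -> False.
Proof.
induction t as [x|f ts IH|Sp X IH] using term_induction; intros ps t0 v p r r' H Hc Ho E.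
- destruct ps as [|[] ps]; try contradiction.
  simpl in H; subst; apply (proj2 Hc x); constructor.
- destruct ps as [|[] ps]; try contradiction.
  + simpl in H; subst; exact (proj2 Hc v (occurs_free _ _ _ Ho)).
  + destruct H as (i & <- & H), Ho as (j & p' & -> & Ho); simpl in E.
    injection E as E1 E2; apply fin_index_inj in E1; subst j; eapply IH; eauto.
- destruct ps as [|[] ps]; try contradiction.
  + simpl in H; subst; exact (proj2 Hc v (occurs_free _ _ _ Ho)).
  + simpl in H; destruct Ho as (_ & Y & p' & -> & Ho); simpl in E.
    injection E as -> E2; destruct (Sp v0) as [u|] eqn:EY; [|contradiction].
    eapply IH; eauto.
Qed.

(** * Sets of marks and the replacement they describe *)

Lemma marks_ext (D E : marks) : (forall ps q, D ps q <-> E ps q) -> D = E.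
Proof.
intros H; extensionality ps; extensionality q; apply propositional_extensionality, H.
Qed.

Definition root_mark (D : marks) : option term :=
  match excluded_middle_informative (exists q, D nil q) with
  | left H => Some (proj1_sig (constructive_indefinite_description _ H))
  | right _ => None
  end.

Definition marks_below (D : marks) (s : step Var) : marks := fun ps q => D (s :: ps) q.

Lemma root_mark_none (D : marks) : (forall q, ~ D nil q) -> root_mark D = None.
Proof.
intros H; unfold root_mark; destruct (excluded_middle_informative _) as [[q Hq]|]; auto.
destruct (H q Hq).
Qed.

Lemma root_mark_spec (D : marks) :
  match root_mark D with Some q => D nil q | None => forall q, ~ D nil q end.
Proof.
unfold root_mark; destruct (excluded_middle_informative _) as [H|H]; [apply proj2_sig|].
intros q Hq; apply H; exists q; exact Hq.
Qed.

Lemma root_mark_ext (D E : marks) : D nil = E nil -> root_mark D = root_mark E.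
Proof. unfold root_mark; intros ->; reflexivity. Qed.

(** The outermost mark on a path wins, since the recursion stops there. Replacements are inserted
    unchanged even under binders, which causes no capture because they are closed in all uses. *)
Fixpoint plug (t : term) (D : marks) : term :=
  match root_mark D with
  | Some q => q
  | None =>
      match t with
      | var x => var x
      | app f ts => app f (fun i => plug (ts i) (marks_below D (arg (fin_index i))))
      | rec Sp X =>
          rec (fun Y => match Sp Y with
                        | Some u => Some (plug u (marks_below D (body Y)))
                        | None => None
                        end) X
      end
  end.

Lemma plug_root (t : term) D q : root_mark D = Some q -> plug t D = q.
Proof. destruct t; simpl; intros ->; reflexivity. Qed.

Definition marks_subst (t : term) (E : Var -> marks) : marks :=
  fun ps q => exists v p1 p2, ps = p1 ++ p2 /\ occurs t v p1 /\ E v p2 q.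

(** Marks of a substitution instance are split into marks [E0] on closed subterms of [u] itself and
    marks [E v] inside the terms substituted for [v]. The two kinds do not interfere: closed
    subterms contain no substituted variable, and closed replacements are unchanged by
    substitution. *)
Lemma plug_subst (u : term) : forall (sigma : Var -> term) (E0 : marks) (E : Var -> marks),
  (forall ps q, E0 ps q -> closed q /\ exists p0, subterm_at ps u p0 /\ closed p0) ->
  plug (subst sigma u) (fun ps q => E0 ps q \/ marks_subst u E ps q) =
  subst (fun v => plug (sigma v) (E v)) (plug u E0).
Proof.
induction u as [x|f ts IH|Sp X IH] using term_induction; intros sigma E0 E HE0.
(* A variable has no closed subterm, so [E0] is empty here. *)
- assert (N : forall ps q, ~ E0 ps q).
  { intros ps q H; destruct (HE0 _ _ H) as (_ & p0 & G & C).
    destruct ps as [|[] ps]; try contradiction.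
    simpl in G; subst; apply (proj2 C x); constructor. }
  simpl; rewrite (root_mark_none E0) by (intros q; apply N); simpl.
  f_equal; apply marks_ext; intros ps q; split.
  + intros [H|(v & p1 & p2 & -> & [-> ->] & H)]; [destruct (N _ _ H)|exact H].
  + intros H; right; exists x, nil, ps; simpl; auto.
(* Variable occurrences lie strictly below the root of an application, so only [E0] can mark the
   root. *)
- assert (RE : root_mark (fun ps q => E0 ps q \/ marks_subst (app f ts) E ps q) =
               root_mark E0).
  { apply root_mark_ext; extensionality q; apply propositional_extensionality.
    split; [|auto]; intros [H|(v & p1 & p2 & G & (i & ps & -> & _) & _)]; [auto|discriminate]. }
  simpl; rewrite RE; pose proof (root_mark_spec E0) as S.
  destruct (root_mark E0) as [q|].
  + rewrite subst_closed; auto; apply (HE0 _ _ S).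
  + simpl; f_equal; extensionality i.
    rewrite <- IH.
    * f_equal; apply marks_ext; intros ps q; unfold marks_below.
      split; intros [H|(v & p1 & p2 & G & H & H')]; auto; right.
      -- destruct H as (j & p1' & -> & H); simpl in G.
         injection G as G1 G2; apply fin_index_inj in G1; subst j ps.
         exists v, p1', p2; auto.
      -- exists v, (arg (fin_index i) :: p1), p2; subst ps; simpl; eauto 6.
    * intros ps q H; destruct (HE0 _ _ H) as (C & p0 & (j & G & G') & C'); split; [exact C|].
      apply fin_index_inj in G; subst j; eauto.
- assert (RE : root_mark (fun ps q => E0 ps q \/ marks_subst (rec Sp X) E ps q) =
               root_mark E0).
  { apply root_mark_ext; extensionality q; apply propositional_extensionality.
    split; [|auto]; intros [H|(v & p1 & p2 & G & (_ & Y & ps & -> & _) & _)]; [auto|discriminate]. }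
  simpl; rewrite RE; pose proof (root_mark_spec E0) as S.
  destruct (root_mark E0) as [q|].
  + rewrite subst_closed; auto; apply (HE0 _ _ S).
  + simpl; f_equal; extensionality Y; destruct (Sp Y) as [u|] eqn:EY; [|reflexivity].
    f_equal.
    (* Variables bound by [Sp] are not substituted in the body, so they carry no marks there. *)
    set (E' := fun v => match Sp v with Some _ => fun _ _ => False | None => E v end : marks).
    replace (shadow (fun Z => match Sp Z with
                              | Some w => Some (plug w (marks_below E0 (body Z)))
                              | None => None end) (fun v => plug (sigma v) (E v)))
      with (fun v => plug (shadow Sp sigma v) (E' v)).
    * rewrite <- (IH Y u EY).
      -- f_equal; apply marks_ext; intros ps q; unfold marks_below.
         split; intros [H|(v & p1 & p2 & G & H & H')]; auto; right.
         ++ destruct H as (Hv & Z & p1' & -> & H); simpl in G.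
            injection G as <- ->; rewrite EY in H.
            exists v, p1', p2; unfold E'; rewrite Hv; auto.
         ++ unfold E' in H'; destruct (Sp v) eqn:Ev; [contradiction|].
            exists v, (body Y :: p1), p2; subst ps; simpl; repeat split; auto.
            exists Y, p1; rewrite EY; auto.
      -- intros ps q H; destruct (HE0 _ _ H) as (C & p0 & G & C'); split; [exact C|].
         simpl in G; rewrite EY in G; eauto.
    * extensionality v; unfold shadow, E'; destruct (Sp v); [|reflexivity].
      simpl; rewrite root_mark_none; auto.
Qed.

Lemma plug_marks_subst (t : term) sigma E :
  plug (subst sigma t) (marks_subst t E) = subst (fun v => plug (sigma v) (E v)) t.
Proof.
assert (N : plug t (fun _ _ => False) = t).
{ clear; induction t as [x|f ts IH|Sp X IH] using term_induction; simpl;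
    rewrite root_mark_none by auto; [reflexivity|f_equal; extensionality i; apply IH|].
  f_equal; extensionality Y; destruct (Sp Y) as [u|] eqn:EY; [|reflexivity].
  f_equal; apply (IH _ _ EY). }
rewrite <- N at 3; rewrite <- plug_subst by contradiction.
f_equal; apply marks_ext; tauto.
Qed.

(** * Comparable positions and consistent sets of marks *)

Definition comparable (x y : pos) : Prop := exists r, y = x ++ r \/ x = y ++ r.

Lemma comparable_app p x y : comparable (p ++ x) (p ++ y) <-> comparable x y.
Proof.
split; intros [r [H|H]]; exists r.
- left; rewrite <- app_assoc in H; exact (app_inv_head _ _ _ H).
- right; rewrite <- app_assoc in H; exact (app_inv_head _ _ _ H).
- left; rewrite <- app_assoc, H; reflexivity.
- right; rewrite <- app_assoc, H; reflexivity.
Qed.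

Lemma comparable_nil x : comparable nil x.
Proof. exists x; auto. Qed.

Lemma comparable_sym x y : comparable x y -> comparable y x.
Proof. intros [r [H|H]]; exists r; auto. Qed.

Lemma occurs_comparable (t : term) v v' p p' x y :
  occurs t v p -> occurs t v' p' -> comparable (p ++ x) (p' ++ y) ->
  p = p' /\ v = v' /\ comparable x y.
Proof.
intros H H' C; assert (G : p = p' /\ v = v').
{ destruct C as [r [E|E]]; rewrite <- app_assoc in E.
  - destruct (occurs_incomparable _ _ _ _ _ _ _ H' H E); auto.
  - exact (occurs_incomparable _ _ _ _ _ _ _ H H' E). }
destruct G as [<- <-]; rewrite comparable_app in C; auto.
Qed.

Lemma closed_subterm_not_comparable (t : term) ps t0 v p r :
  subterm_at ps t t0 -> closed t0 -> occurs t v p -> ~ comparable ps (p ++ r).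
Proof.
intros H C Ho [r' [E|E]].
- exact (closed_subterm_not_occurs _ _ _ _ _ _ _ H C Ho E).
- rewrite <- app_assoc in E; rewrite <- (app_nil_r ps) in E; symmetry in E.
  exact (closed_subterm_not_occurs _ _ _ _ _ _ _ H C Ho E).
Qed.

(** An antichain of positions with a partial function on it; in particular [root_mark] never has a
    real choice. *)
Definition consistent (D : marks) : Prop :=
  forall x c y d, D x c -> D y d -> comparable x y -> x = y /\ c = d.

(** * The compatible closure of a relation, described by marks *)

Section Replacement.
Context (B : term -> term -> Prop).

Definition mark_ok (t : term) (ps : pos) (q : term) : Prop :=
  exists t0, subterm_at ps t t0 /\ B t0 q.

Definition good (D : marks) (t : term) : Prop :=
  consistent D /\ forall ps q, D ps q -> mark_ok t ps q.

Inductive related : term -> term -> Prop :=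
| related_base p q : B p q -> related p q
| related_var x : related (var x) (var x)
| related_app f ts us : (forall i, related (ts i) (us i)) -> related (app f ts) (app f us)
| related_rec Sp Sp' X :
    (forall Y, (Sp Y = None /\ Sp' Y = None) \/
       exists u u', Sp Y = Some u /\ Sp' Y = Some u' /\ related u u') ->
    related (rec Sp X) (rec Sp' X).

Lemma good_below D t s t' : good D t ->
  (forall ps q, mark_ok t (s :: ps) q -> mark_ok t' ps q) ->
  good (marks_below D s) t'.
Proof.
intros [H1 H2] G; split.
- intros x c y d Hx Hy C.
  destruct (H1 _ _ _ _ Hx Hy) as [E1 E2]; [|split; congruence].
  destruct C as [r [->| ->]]; exists r; auto.
- intros ps q H; apply G, H2, H.
Qed.

Lemma good_arg D f ts i : good D (app f ts) ->
  good (marks_below D (arg (fin_index i))) (ts i).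
Proof.
intros H; apply (good_below _ _ _ _ H).
intros ps q (t0 & (j & E & G) & Hb); apply fin_index_inj in E; subst j; exists t0; auto.
Qed.

Lemma good_body D Sp X Y u : good D (rec Sp X) -> Sp Y = Some u ->
  good (marks_below D (body Y)) u.
Proof.
intros H E; apply (good_below _ _ _ _ H).
intros ps q (t0 & G & Hb); simpl in G; rewrite E in G; exists t0; auto.
Qed.

Lemma related_plug (t : term) : forall D, good D t -> related t (plug t D).
Proof.
assert (G0 : forall D t q, good D t -> root_mark D = Some q -> related t q).
{ intros D t1 q [_ H] E; pose proof (root_mark_spec D) as S; rewrite E in S.
  destruct (H _ _ S) as (t0 & G & Hb); simpl in G; subst; apply related_base; exact Hb. }
induction t as [x|f ts IH|Sp X IH] using term_induction; intros D HD; simpl;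
  destruct (root_mark D) as [q|] eqn:E; try (eapply G0; eassumption).
- apply related_var.
- apply related_app; intros i; apply IH, good_arg, HD.
- apply related_rec; intros Y; destruct (Sp Y) as [u|] eqn:EY; [right|left; auto].
  exists u; eexists; repeat split; apply (IH _ _ EY); eapply good_body; eauto.
Qed.

(** Together with [related_plug] this identifies related pairs with replacements along good marks.
    The marks are read off the derivation: a base pair marks the root, and a congruence step
    collects the marks of the components. *)
Lemma plug_of_related t t' : related t t' -> exists D, good D t /\ plug t D = t'.
Proof.
revert t'; induction t as [x|f ts IH|Sp X IH] using term_induction; intros t' H.
all: assert (G0 : forall t, B t t' -> exists D, good D t /\ plug t D = t').
1,3,5: intros t Hb; exists (fun ps q => ps = nil /\ q = t'); split;
  [split; [intros x1 c y d [-> ->] [-> ->]; auto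
          |intros ps q [-> ->]; exists t; simpl; auto]|];
  apply plug_root; match goal with |- root_mark ?D = _ =>
    pose proof (root_mark_spec D) as S; destruct (root_mark D) end;
  [destruct S as [_ ->]; reflexivity|destruct (S t'); auto].
- inversion H; subst; [auto|].
  exists (fun _ _ => False); split; [split; [intros ? ? ? ? []|intros ? ? []]|].
  simpl; rewrite root_mark_none; auto.
(* Quantifying over all [t] before the case analysis avoids equations between argument families
   whose type depends on [f]. *)
- assert (G : B (app f ts) t' \/ exists us, t' = app f us /\ forall i, related (ts i) (us i)).
  { clear G0; enough (G : forall t, related t t' ->
      match t with
      | app f ts => B (app f ts) t' \/ exists us, t' = app f us /\ forall i, related (ts i) (us i)
      | _ => True end) by exact (G _ H).
    intros t Ht; destruct Ht as [p q Hb| | |]; [destruct p|..]; eauto. }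
  destruct G as [G|(us & -> & G)]; [auto|].
  set (D := fun i => proj1_sig (constructive_indefinite_description _ (IH i _ (G i)))).
  assert (HD : forall i, good (D i) (ts i) /\ plug (ts i) (D i) = us i)
    by (intros i; unfold D; apply proj2_sig).
  exists (fun ps q => exists i ps', ps = arg (fin_index i) :: ps' /\ D i ps' q); split; [split|].
  + intros x c y d (i & x' & -> & Hx) (j & y' & -> & Hy) C.
    assert (E : i = j) by
      (destruct C as [r [C|C]]; injection C as C _; apply fin_index_inj in C; congruence).
    subst j; change (comparable ((arg (fin_index i) :: nil) ++ x') ((arg (fin_index i) :: nil) ++ y')) in C.
    rewrite comparable_app in C.
    destruct (HD i) as [[K _] _]; destruct (K _ _ _ _ Hx Hy C) as [-> ->]; auto.
  + intros ps q (i & ps' & -> & Hq); destruct (HD i) as [[_ K] _].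
    destruct (K _ _ Hq) as (t0 & K1 & K2); exists t0; split; [simpl; eauto|exact K2].
  + simpl; rewrite root_mark_none by (intros q (i & ps' & E & _); discriminate).
    f_equal; extensionality i; rewrite <- (proj2 (HD i)); f_equal.
    apply marks_ext; intros ps q; unfold marks_below; split.
    * intros (j & ps' & E & K); injection E as E ->; apply fin_index_inj in E; subst j; exact K.
    * intros K; eauto.
- assert (G : B (rec Sp X) t' \/ exists Sp', t' = rec Sp' X /\
    forall Y, (Sp Y = None /\ Sp' Y = None) \/
       exists u u', Sp Y = Some u /\ Sp' Y = Some u' /\ related u u').
  { inversion H; subst; eauto. }
  destruct G as [G|(Sp' & -> & G)]; [auto|].
  assert (G' : forall Y, exists D, forall u, Sp Y = Some u ->
    good D u /\ Some (plug u D) = Sp' Y).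
  { intros Y; destruct (G Y) as [[E _]|(u & u' & E & E' & K)].
    - exists (fun _ _ => False); congruence.
    - destruct (IH _ _ E _ K) as (D & K1 & K2); exists D; intros w Ew.
      assert (w = u) by congruence; subst w; split; congruence. }
  set (D := fun Y => proj1_sig (constructive_indefinite_description _ (G' Y))).
  assert (HD : forall Y u, Sp Y = Some u -> good (D Y) u /\ Some (plug u (D Y)) = Sp' Y)
    by (intros Y; unfold D; apply proj2_sig).
  (* Outside the domain of [Sp] the chosen [D Y] is arbitrary and must be cut off. *)
  exists (fun ps q => exists Y ps', ps = body Y :: ps' /\ Sp Y <> None /\ D Y ps' q);
    split; [split|].
  + intros x c y d (Y & x' & -> & N & Hx) (Z & y' & -> & _ & Hy) C.
    assert (E : Y = Z) by (destruct C as [r [C|C]]; injection C; congruence).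
    subst Z; change (comparable ((body Y :: nil) ++ x') ((body Y :: nil) ++ y')) in C.
    rewrite comparable_app in C; destruct (Sp Y) as [u|] eqn:EY; [|congruence].
    destruct (HD Y u EY) as [[K _] _]; destruct (K _ _ _ _ Hx Hy C) as [-> ->]; auto.
  + intros ps q (Y & ps' & -> & N & Hq); destruct (Sp Y) as [u|] eqn:EY; [|congruence].
    destruct (HD Y u EY) as [[_ K] _].
    destruct (K _ _ Hq) as (t0 & K1 & K2); exists t0; simpl; rewrite EY; auto.
  + simpl; rewrite root_mark_none by (intros q (i & ps' & E & _); discriminate).
    f_equal; extensionality Y; destruct (Sp Y) as [u|] eqn:EY.
    * rewrite <- (proj2 (HD Y u EY)); do 2 f_equal.
      apply marks_ext; intros ps q; unfold marks_below; split.
      -- intros (Z & ps' & E & _ & K); injection E as -> ->; exact K.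
      -- intros K; exists Y, ps; repeat split; congruence.
    * destruct (G Y) as [[_ E]|(u & u' & E & _)]; congruence.
Qed.

Context (B_closed : forall p q, B p q -> closed p /\ closed q).

Lemma related_wf t t' : related t t' -> wf t -> wf t'.
Proof.
revert t'; induction t as [x|f ts IH|Sp X IH] using term_induction; intros t' H Ht.
- inversion H; subst; [|constructor]; apply (B_closed (var x) t'); auto.
- enough (G : forall t, related t t' ->
    match t with
    | app f ts => (forall i, wf (ts i)) ->
        (forall i u, related (ts i) u -> wf (ts i) -> wf u) -> wf t'
    | _ => True end).
  { apply (G _ H); auto.
    enough (G' : forall t, wf t -> match t with app f ts => forall i, wf (ts i) | _ => True end)
      by exact (G' _ Ht).
    intros t []; auto. }
  intros t K; destruct K as [p q Hb| | |]; auto.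
  + destruct p; auto; intros _ _; apply (B_closed _ _ Hb).
  + intros K1 K2; constructor; intros i; eapply K2; eauto.
- inversion H as [p q Hb| | |? Sp' ? K]; subst; [apply (B_closed _ _ Hb)|].
  inversion Ht as [| |? ? H1 H2]; subst; constructor.
  + destruct (K X) as [[E _]|(u & u' & E & E' & _)]; congruence.
  + intros Y w E; destruct (K Y) as [[_ E']|(u & u' & E1 & E2 & Hu)]; [congruence|].
    assert (w = u') by congruence; subst; eapply IH; eauto.
Qed.

(** Replacements are closed and related specifications bind the same variables, so no variable
    becomes free. *)
Lemma related_free t t' : related t t' -> forall x, free x t' -> free x t.
Proof.
revert t'; induction t as [y|f ts IH|Sp X IH] using term_induction; intros t' H x Hx.
- inversion H; subst; [|exact Hx].
  destruct (B_closed (var y) t') as [_ [_ C]]; [auto|destruct (C x Hx)].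
- enough (G : forall t, related t t' ->
    match t with
    | app f ts => (forall i u, related (ts i) u -> free x u -> free x (ts i)) -> free x (app f ts)
    | _ => True end) by (apply (G _ H); eauto).
  intros t K; destruct K as [p q Hb| |f' ts' us K|]; auto.
  + destruct p; auto; intros _; destruct (B_closed _ _ Hb) as [_ [_ C]]; destruct (C x Hx).
  + intros K2.
    assert (G : exists i, free x (us i)).
    { clear -Hx; enough (G : forall t, free x t ->
        match t with app f ts => exists i, free x (ts i) | _ => True end) by exact (G _ Hx).
      intros t []; eauto. }
    destruct G as [i Hi]; econstructor; eapply K2; eauto.
- inversion H as [p q Hb| | |? Sp' ? K]; subst.
  { destruct (B_closed _ _ Hb) as [_ [_ C]]; destruct (C x Hx). }
  inversion Hx as [| |? ? Y w H1 H2 H3]; subst.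
  destruct (K Y) as [[_ E']|(u & u' & E1 & E2 & Hu)]; [congruence|].
  assert (w = u') by congruence; subst.
  econstructor; [exact E1|eapply IH; eauto|].
  destruct (K x) as [[E _]|(v & v' & _ & E & _)]; congruence.
Qed.

Lemma related_closed t t' : related t t' -> closed t -> closed t'.
Proof.
intros H [H1 H2]; split; [eapply related_wf; eauto|].
intros x Hx; exact (H2 x (related_free _ _ H x Hx)).
Qed.

Lemma plug_closed D t : good D t -> closed t -> closed (plug t D).
Proof. intros H; apply related_closed, related_plug, H. Qed.

Lemma good_marks_subst (t : term) sigma E :
  (forall v, good (E v) (sigma v)) -> good (marks_subst t E) (subst sigma t).
Proof.
intros H; split.
- intros x c y d (v & p1 & p2 & -> & O & Hc) (v' & p1' & p2' & -> & O' & Hd) C.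
  destruct (occurs_comparable _ _ _ _ _ _ _ O O' C) as (<- & <- & C').
  destruct (proj1 (H v) _ _ _ _ Hc Hd C') as [-> ->]; auto.
- intros ps q (v & p1 & p2 & -> & O & Hq).
  destruct (proj2 (H v) _ _ Hq) as (t0 & G & Hb); exists t0; split; [|exact Hb].
  apply (subterm_at_occurs _ sigma _ _ p2 t0 O); exact G.
Qed.

Definition image (T : pos -> term -> marks) (D : marks) : marks :=
  fun ps' q' => exists ps q, D ps q /\ T ps q ps' q'.

(** The second clause is the single-ancestor property: comparable descendants come from comparable
    marks, and distinct descendants of one mark are incomparable. It makes the image of a consistent
    set consistent. *)
Definition propagation (p p' : term) (T : pos -> term -> marks) : Prop :=
  (forall ps q ps' q', T ps q ps' q' -> mark_ok p ps q /\ mark_ok p' ps' q') /\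
  (forall ps1 q1 ps1' q1' ps2 q2 ps2' q2',
     T ps1 q1 ps1' q1' -> T ps2 q2 ps2' q2' -> comparable ps1' ps2' ->
     comparable ps1 ps2 /\ (ps1 = ps2 -> q1 = q2 -> ps1' = ps2' /\ q1' = q2')).

Lemma good_image p p' T D : propagation p p' T -> good D p -> good (image T D) p'.
Proof.
intros [H1 H2] [G1 G2]; split.
- intros x c y d (x0 & c0 & Hx & Tx) (y0 & d0 & Hy & Ty) C.
  destruct (H2 _ _ _ _ _ _ _ _ Tx Ty C) as [C0 K].
  destruct (G1 _ _ _ _ Hx Hy C0); auto.
- intros ps q (x0 & c0 & _ & Tx); exact (proj2 (H1 _ _ _ _ Tx)).
Qed.

End Replacement.

(** Lets one simulation argument serve both clauses of a bisimulation, the second one being run for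
    the converse of [B]. *)
Lemma related_flip (B : term -> term -> Prop) t t' :
  related B t t' -> related (fun p q => B q p) t' t.
Proof.
revert t'; induction t as [x|f ts IH|Sp X IH] using term_induction; intros t' H.
- inversion H; subst; [apply related_base; auto|apply related_var].
- enough (G : forall t, related B t t' ->
    match t with
    | app f ts => (forall i u, related B (ts i) u -> related (fun p q => B q p) u (ts i)) ->
        related (fun p q => B q p) t' (app f ts)
    | _ => True end) by (apply (G _ H); auto).
  intros t K; destruct K as [p q Hb| | |]; auto.
  + destruct p; auto; intros _; apply related_base; exact Hb.
  + intros K; apply related_app; auto.
- inversion H as [p q Hb| | |? Sp' ? K]; subst; [apply related_base; exact Hb|].
  apply related_rec; intros Y; destruct (K Y) as [[E E']|(u & u' & E1 & E2 & Hu)]; [left; auto|].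
  right; exists u', u; repeat split; auto; eapply IH; eauto.
Qed.

End Marks.

(** * Propagation of marks along proofs *)

Section Simulation.
Context {Var F : Type} {arity : F -> nat} {A : Type}.
Notation term := (term Var F arity).
Notation lit := (lit Var F arity A).
Notation pos := (list (step Var)).
Notation marks := (pos -> term -> Prop).
Context (R : rule Var F arity A -> Prop).
Context (Hformat : forall r, R r -> ntyft r \/ ntyxt r).

Lemma format_ntytt r : R r -> ntytt r.
Proof. intros H; destruct (Hformat r H) as [[G _]|[G _]]; exact G. Qed.

Lemma format_source_wf r : R r -> wf (csrc r).
Proof.
intros H; destruct (Hformat r H) as [[_ (f & xs & _ & ->)]|[_ [x ->]]]; repeat constructor.
Qed.

Lemma format_source_linear r v p p' :
  R r -> occurs (csrc r) v p -> occurs (csrc r) v p' -> p = p'.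
Proof.
intros H; destruct (Hformat r H) as [[_ (f & xs & inj & ->)]|[_ [x ->]]]; simpl.
- intros (i & q & -> & E & ->) (j & q' & -> & E' & ->).
  assert (i = j) by (apply inj; congruence); subst; reflexivity.
- intros [_ ->] [_ ->]; reflexivity.
Qed.

(** The source is a variable or one function symbol over variables, so everything strictly below the
    root of an instance belongs to the value of a source variable. *)
Lemma format_source_below r sigma ps t0 :
  R r -> ps <> nil -> subterm_at ps (subst sigma (csrc r)) t0 ->
  exists v p1 p2, ps = p1 ++ p2 /\ occurs (csrc r) v p1.
Proof.
intros H N; destruct (Hformat r H) as [[_ (f & xs & inj & ->)]|[_ [x ->]]]; simpl.
- destruct ps as [|[n|Y] ps]; [congruence| |contradiction].
  intros (i & <- & _); exists (xs i), (arg (fin_index i) :: nil), ps; split; [reflexivity|].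
  exists i, nil; auto.
- intros _; exists x, nil, ps; auto.
Qed.

Context (B : term -> term -> Prop).

(** The marks that a mark [c] at [x] of the source induces on the value of each variable of the
    rule. The root [x = nil] is excluded, as it is answered by the game in [simulated_root]. *)
Inductive spread (r : rule Var F arity A) (p : term)
  (T : term -> A -> Var -> pos -> term -> marks) (x : pos) (c : term) : Var -> marks :=
| spread_source v p1 ps : x <> nil -> x = p1 ++ ps -> occurs (csrc r) v p1 ->
    mark_ok B p x c -> spread r p T x c v ps c
| spread_premise s b y v p1 ps q ps' q' : prem r (Pos s b (var y)) ->
    spread r p T x c v ps q -> occurs s v p1 -> T s b y (p1 ++ ps) q ps' q' ->
    spread r p T x c y ps' q'.

Lemma spread_origin r p T x c v ps q :
  spread r p T x c v ps q -> x <> nil /\ mark_ok B p x c.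
Proof. intros H; induction H; auto. Qed.

Lemma spread_ok r rho T x c v ps q :
  (forall s b y, prem r (Pos s b (var y)) ->
     propagation B (subst rho s) (rho y) (T s b y)) ->
  spread r (subst rho (csrc r)) T x c v ps q -> mark_ok B (rho v) ps q.
Proof.
intros HT H; induction H as [v p1 ps _ -> O (t0 & G & Hb)|s b y v p1 ps q ps' q' Hp _ _ O HTq].
- exists t0; split; [|exact Hb]; apply (subterm_at_occurs _ rho _ _ ps t0 O); exact G.
- exact (proj2 (proj1 (HT _ _ _ Hp) _ _ _ _ HTq)).
Qed.

(** Source variables occur once and are not premise targets, and a target determines its premise.
    Two comparable marks on one variable therefore arise by the same last step, and both can be
    traced back in parallel to the source. *)
Lemma spread_comparable r rho T x c v ps q x' c' ps' q' :
  R r ->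
  (forall s b y, prem r (Pos s b (var y)) ->
     propagation B (subst rho s) (rho y) (T s b y)) ->
  spread r (subst rho (csrc r)) T x c v ps q ->
  spread r (subst rho (csrc r)) T x' c' v ps' q' ->
  comparable ps ps' ->
  comparable x x' /\ (x = x' -> c = c' -> ps = ps' /\ q = q').
Proof.
intros Hr HT H; destruct (format_ntytt r Hr) as [Hy Hu].
assert (Nfree : forall s b y p, prem r (Pos s b (var y)) -> ~ occurs (csrc r) y p).
{ intros s b y p1 Hp O; destruct (Hy _ _ _ Hp) as (y' & E & N); injection E as <-.
  exact (N (occurs_free _ _ _ O)). }
revert ps' q'.
induction H as [v p1 ps _ -> O _|s b y v p1 ps q ps1 q1 Hp Hs IH O HTq]; intros ps' q' H' C.
- inversion H' as [v' p1' ps0 _ E O' _|s b y v' p1' ps0 q0 ps0' q0' Hp]; subst.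
  + pose proof (format_source_linear r _ _ _ Hr O O'); subst p1'.
    split; [rewrite comparable_app; exact C|].
    intros E ->; split; [exact (app_inv_head _ _ _ E)|reflexivity].
  + destruct (Nfree _ _ _ _ Hp O).
- inversion H' as [v' p1' ps0 _ E O' _|s' b' y' v' p1' ps0 q0 ps0' q0' Hp' Hs' O' HTq']; subst.
  + destruct (Nfree _ _ _ _ Hp O').
  + destruct (Hu _ _ _ _ _ Hp Hp') as [<- <-].
    destruct (proj2 (HT _ _ _ Hp) _ _ _ _ _ _ _ _ HTq HTq' C) as [C1 K1].
    destruct (occurs_comparable _ _ _ _ _ _ _ O O' C1) as (<- & <- & C2).
    destruct (IH _ _ Hs' C2) as [C3 K2]; split; [exact C3|].
    intros E1 E2; destruct (K2 E1 E2) as [-> ->]; auto.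
Qed.

Context (B_closed : forall p q, B p q -> closed p /\ closed q).
Context (C1 C2 : term -> A -> term -> Prop).
Context (B_sim : forall p q a p', B p q -> Gamma R C1 p a p' ->
           exists q', Gamma R C2 q a q' /\ B p' q').
Context (neg_sim : forall p q a, closed p -> closed q -> related B p q ->
           (forall p', ~ C1 p a p') -> forall q', ~ C2 q a q').

Definition simulated_by (p : term) (a : A) (p' : term) (T : pos -> term -> marks)
  (D : marks) : Prop :=
  proves R (denying_none C2) (Pos (plug p D) a (plug p' (image T D))).

(** [T] is chosen before [D]: the marks on the premises of a rule are computed from the propagations
    of all its premises, so these may not depend on the marks. *)
Definition simulated (l : lit) : Prop :=
  match l with
  | Pos p a p' => closed p' -> exists T, propagation B p p' T /\
      forall D, good B D p -> simulated_by p a p' T D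
  | Neg p a => forall D, good B D p -> proves R (denying_none C2) (Neg (plug p D) a)
  end.

(** Reduces the task to marks below the root: a marked root is replaced as a whole, and [B_sim]
    provides the answering transition, whose target marks the root of [p']. *)
Lemma simulated_root p a p' T0 :
  Gamma R C1 p a p' -> propagation B p p' T0 ->
  (forall ps q ps' q', T0 ps q ps' q' -> ps <> nil) ->
  (forall D, good B D p -> (forall q, ~ D nil q) -> simulated_by p a p' T0 D) ->
  exists T, propagation B p p' T /\ forall D, good B D p -> simulated_by p a p' T D.
Proof.
intros HG [P1 P2] N S.
assert (M : forall q, exists q', B p q -> Gamma R C2 q a q' /\ B p' q').
{ intros q; destruct (classic (B p q)) as [Hb|Hb].
  - destruct (B_sim _ _ _ _ Hb HG) as [q' K]; exists q'; auto.
  (* An arbitrary default where [B p q] fails. *)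
  - exists q; contradiction. }
set (m := fun q => proj1_sig (constructive_indefinite_description _ (M q))).
assert (Hm : forall q, B p q -> Gamma R C2 q a (m q) /\ B p' (m q))
  by (intros q; unfold m; apply proj2_sig).
exists (fun ps q ps' q' => T0 ps q ps' q' \/ (ps = nil /\ ps' = nil /\ B p q /\ q' = m q)).
split; [split|].
- intros ps q ps' q' [H|(-> & -> & Hb & ->)]; [eauto|].
  split; [exists p|exists p']; split; simpl; auto; apply Hm, Hb.
- intros ps1 q1 ps1' q1' ps2 q2 ps2' q2' [H|(-> & -> & Hb & ->)] [H'|(-> & -> & Hb' & ->)] C.
  + eauto.
  + split; [apply comparable_sym, comparable_nil|]; intros ->; destruct (N _ _ _ _ H eq_refl).
  + split; [apply comparable_nil|]; intros <-; destruct (N _ _ _ _ H' eq_refl).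
  + split; [apply comparable_nil|]; intros _ ->; auto.
- intros D HD; unfold simulated_by.
  pose proof (root_mark_spec D) as SD; destruct (root_mark D) as [q|] eqn:E.
  + rewrite (plug_root p D q E).
    assert (Hb : B p q) by (destruct (proj2 HD _ _ SD) as (t0 & K & Hb); simpl in K; subst; exact Hb).
    match goal with |- context [plug p' ?I] =>
      pose proof (root_mark_spec I) as SI; destruct (root_mark I) as [q'|] eqn:E' end.
    * rewrite (plug_root _ _ _ E').
      assert (q' = m q).
      { destruct SI as (x & c & Hx & K).
        destruct (proj1 HD _ _ _ _ SD Hx (comparable_nil x)) as [<- <-].
        destruct K as [K|(_ & _ & _ & K)]; [destruct (N _ _ _ _ K eq_refl)|exact K]. }
      subst q'; apply Hm; exact Hb.
    * exfalso; apply (SI (m q)); exists nil, q; auto 7.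
  + match goal with |- context [plug p' ?I] => replace I with (image T0 D) end; [exact (S D HD SD)|].
    apply marks_ext; intros ps q; split; intros (x & c & Hx & K); exists x, c; auto.
    destruct K as [K|(-> & _)]; [auto|destruct (SD _ Hx)].
Qed.

Lemma simulated_rule r rho :
  R r -> closed_subst rho ->
  (forall l, prem r l -> proves R (denying_none C1) (subst_lit rho l)) ->
  (forall l, prem r l -> simulated (subst_lit rho l)) ->
  simulated (Pos (subst rho (csrc r)) (cact r) (subst rho (ctgt r))).
Proof.
intros Hr Hrho Hp IH Hc.
assert (HTex : forall s b y, exists T, prem r (Pos s b (var y)) ->
  propagation B (subst rho s) (rho y) T /\
  forall D, good B D (subst rho s) -> simulated_by (subst rho s) b (rho y) T D).
{ intros s b y; destruct (classic (prem r (Pos s b (var y)))) as [H|H].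
  - destruct (IH _ H (Hrho y)) as [T K]; exists T; auto.
  - exists (fun _ _ _ _ => False); contradiction. }
set (T := fun s b y => proj1_sig (constructive_indefinite_description _ (HTex s b y))).
assert (HT : forall s b y, prem r (Pos s b (var y)) ->
  propagation B (subst rho s) (rho y) (T s b y) /\
  forall D, good B D (subst rho s) -> simulated_by (subst rho s) b (rho y) (T s b y) D)
  by (intros s b y; unfold T; apply proj2_sig).
clearbody T; clear HTex.
assert (HT1 : forall s b y, prem r (Pos s b (var y)) ->
  propagation B (subst rho s) (rho y) (T s b y)) by (intros; apply HT; auto).
destruct (format_ntytt r Hr) as [Hy Hu].
set (p := subst rho (csrc r)) in *.
assert (HG : Gamma R C1 p (cact r) (subst rho (ctgt r))).
{ split; [|split; [exact Hc|apply pr_rule; auto]].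
  apply closed_subst_wf; auto; apply format_source_wf; auto. }
apply (simulated_root _ _ _ (fun x c => marks_subst (ctgt r) (spread r p T x c)) HG).
- split.
  + intros ps q ps' q' (v & p1 & p2 & -> & O & H).
    split; [exact (proj2 (spread_origin _ _ _ _ _ _ _ _ H))|].
    destruct (spread_ok _ _ _ _ _ _ _ _ HT1 H) as (t0 & K & Hb).
    exists t0; split; [|exact Hb]; apply (subterm_at_occurs _ rho _ _ p2 t0 O); exact K.
  + intros ps1 q1 ps1' q1' ps2 q2 ps2' q2' (v & p1 & p2 & -> & O & H) (v' & p1' & p2' & -> & O' & H') C.
    destruct (occurs_comparable _ _ _ _ _ _ _ O O' C) as (<- & <- & C').
    destruct (spread_comparable _ _ _ _ _ _ _ _ _ _ _ _ Hr HT1 H H' C') as [K1 K2].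
    split; [exact K1|]; intros E1 E2; destruct (K2 E1 E2) as [-> ->]; auto.
- intros ps q ps' q' (v & p1 & p2 & _ & _ & H); exact (proj1 (spread_origin _ _ _ _ _ _ _ _ H)).
- intros D HD ND; unfold simulated_by.
  (* The marks arriving at the value of each variable, for all variables at once. *)
  set (E := fun v => image (fun x c => spread r p T x c v) D).
  assert (GE : forall v, good B (E v) (rho v)).
  { intros v; split.
    - intros x c y d (x0 & c0 & Hx & Kx) (y0 & d0 & Hy0 & Ky) C.
      destruct (spread_comparable _ _ _ _ _ _ _ _ _ _ _ _ Hr HT1 Kx Ky C) as [C0 K].
      destruct (proj1 HD _ _ _ _ Hx Hy0 C0); auto.
    - intros ps q (x & c & _ & K); exact (spread_ok _ _ _ _ _ _ _ _ HT1 K). }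
  (* With the root unmarked, all marks lie inside the values of source variables, and these
     variables receive marks from nowhere else. *)
  assert (ED : D = marks_subst (csrc r) E).
  { apply marks_ext; intros ps q; split.
    - intros H; assert (N : ps <> nil) by (intros ->; exact (ND _ H)).
      pose proof (proj2 HD _ _ H) as Hok; destruct Hok as (t0 & K & Hb).
      destruct (format_source_below _ _ _ _ Hr N K) as (v & p1 & p2 & -> & O).
      exists v, p1, p2; repeat split; auto.
      exists (p1 ++ p2), q; split; [exact H|]; econstructor; eauto.
      exists t0; auto.
    - intros (v & p1 & p2 & -> & O & x & c & Hx & K).
      inversion K as [v' p1' ps0 _ E0 O' _|s b y v' p1' ps0 q0 ps0' q0' Hpy]; subst.
      + rewrite (format_source_linear r _ _ _ Hr O O'); exact Hx.
      + destruct (Hy _ _ _ Hpy) as (y' & E0 & N); injection E0 as <-.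
        destruct (N (occurs_free _ _ _ O)). }
  assert (EI : image (fun x c => marks_subst (ctgt r) (spread r p T x c)) D =
               marks_subst (ctgt r) E).
  { apply marks_ext; intros ps q; split.
    - intros (x & c & Hx & v & p1 & p2 & -> & O & K); exists v, p1, p2; repeat split; auto.
      exists x, c; auto.
    - intros (v & p1 & p2 & -> & O & x & c & Hx & K); exists x, c; split; [auto|].
      exists v, p1, p2; auto. }
  rewrite EI; replace (plug p D) with (plug p (marks_subst (csrc r) E)) by (rewrite <- ED; reflexivity).
  (* The same rule is applied under the substitution that sends [v] to [plug (rho v) (E v)]. *)
  unfold p; rewrite !plug_marks_subst; clear ED EI.
  apply pr_rule; [exact Hr|intros v; apply (plug_closed B B_closed); auto|].
  intros [s b u|s b] Hl; simpl.
  + destruct (Hy _ _ _ Hl) as (y & -> & Ny); simpl.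
    pose proof (proj2 (HT _ _ _ Hl) _ (good_marks_subst B s rho E GE)) as S.
    unfold simulated_by in S; rewrite plug_marks_subst in S.
    (* A target variable gets its marks exactly through its unique premise, so the least relation
       satisfies this equation even when premises are circular. *)
    replace (E y) with (image (T s b y) (marks_subst s E)); [exact S|].
    apply marks_ext; intros ps q; split.
    * intros (x & c & (v & p1 & p2 & -> & O & x0 & c0 & Hx & K) & K').
      exists x0, c0; split; [exact Hx|]; econstructor; eauto.
    * intros (x0 & c0 & Hx & K).
      inversion K as [v' p1' ps0 _ E0 O' _|s' b' y' v' p1' ps0 q0 ps0' q0' Hpy Ks O' KT]; subst.
      -- destruct (Ny (occurs_free _ _ _ O')).
      -- destruct (Hu _ _ _ _ _ Hl Hpy) as [<- <-].
         exists (p1' ++ ps0), q0; split; [|exact KT].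
         exists v', p1', ps0; repeat split; auto; exists x0, c0; auto.
  + pose proof (IH _ Hl _ (good_marks_subst B s rho E GE)) as S.
    rewrite plug_marks_subst in S; exact S.
Qed.

(** Unfolding copies marks: those in the body of [X] stay, and each occurrence of a bound variable
    receives a copy of all marks below the root. *)
Lemma simulated_rec Sp X a q :
  closed (rec Sp X) -> closed q ->
  proves R (denying_none C1) (Pos (unfold Sp X) a q) ->
  simulated (Pos (unfold Sp X) a q) -> simulated (Pos (rec Sp X) a q).
Proof.
intros Hc Hq Hp IH _; destruct (IH Hq) as (T & HT & S); clear IH.
destruct (Sp X) as [u|] eqn:EX.
2: { destruct Hc as [Hw _]; inversion Hw; subst; contradiction. }
assert (HG : Gamma R C1 (rec Sp X) a q)
  by (split; [exact Hc|split; [exact Hq|apply pr_rec; auto]]).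
set (theta := fun Y => match Sp Y with Some _ => rec Sp Y | None => var Y end).
assert (EU : unfold Sp X = subst theta u) by (unfold unfold; rewrite EX; reflexivity).
(* [U x y] says that a mark at [x] of the recursive term has a copy at [y] of its unfolding. *)
set (U := fun x y : pos => x = body X :: y \/
  exists v p1, occurs u v p1 /\ Sp v <> None /\ x <> nil /\ y = p1 ++ x).
assert (Uok : forall x y c, U x y -> mark_ok B (rec Sp X) x c -> mark_ok B (unfold Sp X) y c).
{ intros x y c H (t0 & K & Hb); exists t0; split; [|exact Hb]; rewrite EU.
  destruct H as [->|(v & p1 & O & N & N' & ->)].
  - simpl in K; rewrite EX in K; apply subterm_at_closed; [apply (B_closed _ _ Hb)|exact K].
  - apply (subterm_at_occurs _ theta _ _ x t0 O); unfold theta.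
    destruct (Sp v); [|contradiction].
    destruct x as [|[n|Y] x]; [contradiction|contradiction|exact K]. }
assert (Ucomp : forall x1 y1 c1 x2 y2 c2, U x1 y1 -> U x2 y2 ->
  mark_ok B (rec Sp X) x1 c1 -> mark_ok B (rec Sp X) x2 c2 -> comparable y1 y2 ->
  comparable x1 x2 /\ (x1 = x2 -> y1 = y2)).
(* A marked subterm of the body is closed, hence contains no bound variable at which a copy could
   sit. *)
{ assert (K0 : forall y1 x2 c1 v p1, mark_ok B (rec Sp X) (body X :: y1) c1 ->
    occurs u v p1 -> ~ comparable y1 (p1 ++ x2)).
  { intros y1 x2 c1 v p1 (t0 & K & Hb) O; simpl in K; rewrite EX in K.
    eapply closed_subterm_not_comparable; eauto; apply (B_closed _ _ Hb). }
  intros x1 y1 c1 x2 y2 c2 [->|(v & p1 & O & N & N' & ->)] [->|(v' & p1' & O' & M & M' & ->)] H1 H2 C.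
  - split; [|intros E; injection E; auto].
    apply (comparable_app (body X :: nil)); exact C.
  - destruct (K0 _ _ _ _ _ H1 O' C).
  - destruct (K0 _ _ _ _ _ H2 O (comparable_sym _ _ C)).
  - destruct (occurs_comparable _ _ _ _ _ _ _ O O' C) as (<- & _ & C').
    split; [exact C'|intros ->; reflexivity]. }
apply (simulated_root _ _ _
  (fun x c x' c' => mark_ok B (rec Sp X) x c /\ exists y, U x y /\ T y c x' c') HG).
- split.
  + intros ps c ps' c' (H & y & _ & K); split; [exact H|exact (proj2 (proj1 HT _ _ _ _ K))].
  + intros ps1 c1 ps1' c1' ps2 c2 ps2' c2' (H & y & HU & K) (H' & y' & HU' & K') C.
    destruct (proj2 HT _ _ _ _ _ _ _ _ K K' C) as [L1 L2].
    destruct (Ucomp _ _ _ _ _ _ HU HU' H H' L1) as [L3 L4]; split; auto.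
- intros ps c ps' c' (_ & y & [->|(v & p1 & _ & _ & N & _)] & _); [discriminate|exact N].
- intros D HD ND; unfold simulated_by.
  set (D' := fun y c => exists x, U x y /\ D x c).
  assert (GD : good B D' (unfold Sp X)).
  { split.
    - intros y1 c1 y2 c2 (x1 & U1 & H1) (x2 & U2 & H2) C.
      destruct (Ucomp _ _ _ _ _ _ U1 U2 (proj2 HD _ _ H1) (proj2 HD _ _ H2) C) as [L1 L2].
      destruct (proj1 HD _ _ _ _ H1 H2 L1); auto.
    - intros y c (x & HU & H); exact (Uok _ _ _ HU (proj2 HD _ _ H)). }
  replace (image _ D) with (image T D').
  2: { apply marks_ext; intros ps c; split.
       - intros (y & d & (x & HU & H) & K); exists x, d; split; [exact H|].
         split; [exact (proj2 HD _ _ H)|exists y; auto].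
       - intros (x & d & H & _ & y & HU & K); exists y, d; split; [exists x; auto|exact K]. }
  pose proof (S D' GD) as S'; unfold simulated_by in S'.
  pose proof (plug_closed B B_closed D _ HD Hc) as Hc'.
  assert (RD : root_mark D = None) by (apply root_mark_none; exact ND).
  simpl in Hc' |- *; rewrite RD in Hc' |- *.
  apply pr_rec; [exact Hc'| |].
  + apply (plug_closed B B_closed); [|exact Hq]; eapply good_image; eauto.
  + match goal with |- proves _ _ (Pos ?x _ _) => replace x with (plug (unfold Sp X) D') end;
      [exact S'|].
    set (E := fun v => match Sp v with Some _ => D | None => fun _ _ => False end : marks).
    replace D' with (fun ps c => marks_below D (body X) ps c \/ marks_subst u E ps c).
    2: { apply marks_ext; intros ps c; split.
         - intros [H|(v & p1 & p2 & -> & O & H)].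
           + exists (body X :: ps); split; [left; reflexivity|exact H].
           + unfold E in H; destruct (Sp v) eqn:Ev; [|contradiction].
             exists p2; split; [right|exact H]; exists v, p1; repeat split; auto; [congruence|].
             intros ->; exact (ND _ H).
         - intros (x & [->|(v & p1 & O & N & _ & ->)] & H); [left; exact H|right].
           exists v, p1, x; repeat split; auto; unfold E; destruct (Sp v); [exact H|congruence]. }
    rewrite EU, plug_subst.
    * unfold unfold; rewrite EX; f_equal; extensionality v; unfold theta, E.
      destruct (Sp v); simpl; [rewrite RD; reflexivity|].
      rewrite root_mark_none; auto.
    * intros ps c H; destruct (proj2 HD _ _ H) as (t0 & K & Hb); simpl in K; rewrite EX in K.
      destruct (B_closed _ _ Hb); eauto.
Qed.

Lemma proves_simulated l : proves R (denying_none C1) l -> simulated l.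
Proof.
intros H; induction H as [l Hl|r rho Hr Hrho Hp IH|Sp X a q Hc Hq Hp IH].
- destruct Hl as (t & a & -> & Ht & N); intros D HD; apply pr_hyp.
  pose proof (plug_closed B B_closed D t HD Ht) as Hc.
  exists (plug t D), a; repeat split; try apply Hc.
  apply (neg_sim t); auto; apply related_plug; exact HD.
- apply simulated_rule; auto.
- apply simulated_rec; auto.
Qed.

Lemma related_simulation p q a p' :
  related B p q -> Gamma R C1 p a p' ->
  exists q', Gamma R C2 q a q' /\ related B p' q'.
Proof.
intros H (Hp & Hp' & K); destruct (plug_of_related B _ _ H) as (D & HD & <-).
destruct (proves_simulated _ K Hp') as (T & HT & S).
pose proof (good_image B _ _ _ _ HT HD) as HI.
exists (plug p' (image T D)); split; [|apply related_plug; exact HI].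
split; [|split; [|apply S; exact HD]]; apply (plug_closed B B_closed); auto.
Qed.

End Simulation.

(** * The stages of the well-founded semantics *)

Section Semantics.
Context {Var F : Type} {arity : F -> nat} {A : Type}.
Notation term := (term Var F arity).
Context (R : rule Var F arity A -> Prop).

Lemma proves_mono (H H' : lit Var F arity A -> Prop) l :
  (forall k, H k -> H' k) -> proves R H l -> proves R H' l.
Proof.
intros K G; induction G; [apply pr_hyp; auto|apply pr_rule; auto|apply pr_rec; auto].
Qed.

Lemma Gamma_antitone (C C' : term -> A -> term -> Prop) p a q :
  (forall p a q, C p a q -> C' p a q) -> Gamma R C' p a q -> Gamma R C p a q.
Proof.
intros K (H1 & H2 & H3); split; [|split]; auto.
revert H3; apply proves_mono; intros l (t & b & E & Ht & N); exists t, b; repeat split; auto;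
  try apply Ht; intros t' H; exact (N t' (K _ _ _ H)).
Qed.

(** Knaster-Tarski: each [X] in the definition contains [CT R], and the twofold [Gamma R] is
    monotone. *)
Lemma CT_prefixpoint p a q : Gamma R (Gamma R (CT R)) p a q -> CT R p a q.
Proof.
intros H X HX; apply HX; revert H; apply Gamma_antitone; intros p1 a1 q1; apply Gamma_antitone.
intros p2 a2 q2 H; exact (H X HX).
Qed.

(** The other Knaster-Tarski inequality: by monotonicity the right-hand side is itself a
    prefixpoint. *)
Lemma CT_postfixpoint p a q : CT R p a q -> Gamma R (PT R) p a q.
Proof.
intros H; apply H; intros p1 a1 q1; apply Gamma_antitone; intros p2 a2 q2; apply Gamma_antitone.
exact CT_prefixpoint.
Qed.

Lemma refines_bisimulation : bisimulation R (refines R).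
Proof.
intros p q (Rel & HR & H); destruct (HR _ _ H) as (Hp & Hq & H1 & H2).
repeat split; try apply Hp; try apply Hq.
- intros a p' K; destruct (H1 _ _ K) as (q' & G1 & G2); exists q'; split; [exact G1|exists Rel; auto].
- intros a q' K; destruct (H2 _ _ K) as (p' & G1 & G2); exists p'; split; [exact G1|exists Rel; auto].
Qed.

Lemma refines_closed p q : refines R p q -> closed p /\ closed q.
Proof. intros H; destruct (refines_bisimulation _ _ H) as (? & ? & _); auto. Qed.

Context (Hformat : forall r, R r -> ntyft r \/ ntyxt r).

Notation rel := (related (refines R)).

(** The simulation run backwards. [X] is a part of [CT R] whose transitions are already known to be
    matched; this suffices for the negative leaves, so the lemma is available both during the
    induction for [CT R] and after it. *)
Lemma related_PT (X : term -> A -> term -> Prop) :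
  (forall p a p', X p a p' -> CT R p a p' /\ forall q, rel p q -> exists q', CT R q a q') ->
  forall p q a q', rel p q -> PT R q a q' -> exists p', Gamma R X p a p' /\ related (fun p q => refines R q p) q' p'.
Proof.
intros HX p q a q' H K.
apply (related_simulation R Hformat (fun p q => refines R q p)) with (C1 := CT R) (p := q).
- intros p1 q1 G; apply and_comm, refines_closed, G.
- intros p1 q1 b p1' G K1.
  destruct (refines_bisimulation _ _ G) as (_ & _ & _ & G2).
  destruct (G2 _ _ K1) as (q1' & K2 & K3); exists q1'; split; [|exact K3].
  revert K2; apply Gamma_antitone; intros p2 a2 q2 K2; apply HX, K2.
- intros p1 q1 b _ _ G N q1' K1; apply related_flip in G.
  destruct (proj2 (HX _ _ _ K1) _ G) as [p1' K2]; exact (N _ K2).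
- apply related_flip in H; exact H.
- exact K.
Qed.

Lemma related_CT p a p' :
  CT R p a p' -> forall q, rel p q -> exists q', CT R q a q' /\ rel p' q'.
Proof.
(* Induction on stages: since [CT R] is the least prefixpoint, it suffices that the set of matched
   transitions is one. *)
intros H; set (X := fun p a p' => CT R p a p' /\
  forall q, rel p q -> exists q', CT R q a q' /\ rel p' q').
enough (K : X p a p') by apply K.
assert (HX : forall p a p', X p a p' -> CT R p a p') by (intros ? ? ? K; apply K).
apply H; clear p a p' H; intros p a p' H.
assert (toCT : forall p a p', Gamma R (Gamma R X) p a p' -> CT R p a p').
{ intros p1 a1 p1' K; apply CT_prefixpoint; revert K; apply Gamma_antitone.
  intros p2 a2 p2'; apply Gamma_antitone, HX. }
split; [apply toCT, H|]; intros q Hq.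
(* A negative leaf excludes transitions in [Gamma R X]; [related_PT] turns this into their absence
   from [PT R] for the related term. *)
destruct (related_simulation R Hformat (refines R) refines_closed (Gamma R X) (PT R))
  with (p := p) (q := q) (a := a) (p' := p') as (q' & K1 & K2); auto.
- intros p1 q1 b p1' G K.
  destruct (refines_bisimulation _ _ G) as (_ & _ & G1 & _).
  destruct (G1 _ _ (toCT _ _ _ K)) as (q1' & K2 & K3); exists q1'; split; [|exact K3].
  apply CT_postfixpoint, K2.
- intros p1 q1 b _ _ G N q1' K.
  destruct (related_PT X) with (p := p1) (q := q1) (a := b) (q' := q1') as (p1' & K1 & _); auto.
  + intros p2 a2 p2' [K1 K2]; split; [exact K1|].
    intros q2 G2; destruct (K2 _ G2) as (q2' & K3 & _); exists q2'; exact K3.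
  + exact (N _ K1).
- exists q'; split; [apply CT_prefixpoint, K1|exact K2].
Qed.

Lemma related_bisimulation :
  bisimulation R (fun p q => closed p /\ closed q /\ rel p q).
Proof.
intros p q (Hp & Hq & H); split; [exact Hp|split; [exact Hq|split]].
- intros a p' K; destruct (related_CT _ _ _ K _ H) as (q' & K1 & K2); exists q'.
  destruct (CT_postfixpoint _ _ _ K) as (_ & C & _).
  destruct (CT_postfixpoint _ _ _ K1) as (_ & C' & _); auto.
- intros a q' K.
  destruct (related_PT (CT R)) with (p := p) (q := q) (a := a) (q' := q') as (p' & K1 & K2); auto.
  + intros p1 a1 p1' K1; split; [exact K1|]; intros q1 G.
    destruct (related_CT _ _ _ K1 _ G) as (q1' & K2 & _); exists q1'; exact K2.
  + apply related_flip in K2; exists p'.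
    pose proof K as (_ & C & _); pose proof K1 as (_ & C' & _); auto.
Qed.

End Semantics.

(** * The lean precongruence property *)

Lemma related_subst {Var F arity} (B : term Var F arity -> term Var F arity -> Prop) t :
  forall sigma tau, (forall x, related B (sigma x) (tau x)) ->
  related B (subst sigma t) (subst tau t).
Proof.
induction t as [x|f ts IH|Sp X IH] using term_induction; intros sigma tau H; simpl.
- apply H.
- apply related_app; intros i; apply IH, H.
- apply related_rec; intros Y; destruct (Sp Y) as [u|] eqn:E; [right|left; auto].
  do 2 eexists; repeat split; apply (IH _ _ E); intros x; unfold shadow.
  destruct (Sp x); [apply related_var|apply H].
Qed.

Theorem mainTheorem6
  (Var F : Type) (arity : F -> nat) (A : Type)
  (R : rule Var F arity A -> Prop)
  (Hvar : forall l : list Var, exists x, ~ In x l)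
  (Hformat : forall r, R r -> ntyft r \/ ntyxt r) :
  forall (t : term Var F arity) (rho nu : Var -> term Var F arity),
    wf t -> closed_subst rho -> closed_subst nu ->
    (forall x, refines R (rho x) (nu x)) ->
    refines R (subst rho t) (subst nu t).
Proof.
(* The witnessing bisimulation is the compatible closure of [refines R] restricted to closed
   terms. *)
intros t rho nu Ht Hrho Hnu H; eexists; split; [exact (related_bisimulation R Hformat)|].
split; [apply closed_subst_wf; auto|split; [apply closed_subst_wf; auto|]].
apply related_subst; intros x; apply related_base, H.
Qed.
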